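(* Suppose $g$ is twice continuously differentiable and strongly convex with constant $l$, and $\nabla^2 g$ is Lipschitz continuous with constant $L_2$. Consider the SEP-QN method (described in the context) in which the surrogate problem $\min_{\mathbf{x}}\hat f_k(\mathbf{x})$ is solved by continuation SCD, i.e. solved exactly, at every iteration. If $\mathbf{x}_0$ is sufficiently close to $\mathbf{x}^*$, the sequence $\{\mathbf{H}_k\}$ satisfies the Dennis–Moré criterion, and $l\mathbf{I}\preceq\mathbf{H}_k\preceq L\mathbf{I}$ for all $k$, for some $0<l\le L$, then after sufficiently many iterations $\{\mathbf{x}_k\}$ converges superlinearly to $\mathbf{x}^*$, i.e. $\mathbf{x}_k\to\mathbf{x}^*$ and $\|\mathbf{x}_{k+1}-\mathbf{x}^*\|_2=o(\|\mathbf{x}_k-\mathbf{x}^*\|_2)$ as $k\to\infty$. (Here ''sufficiently close'' means: there is $\delta>0$ such that the conclusion holds for every run with $\mathbf{x}_0\in\mathrm{dom} f$, $\|\mathbf{x}_0-\mathbf{x}^*\|_2<\delta$, satisfying the other hypotheses.)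
   Context: Problem: minimize $f(\mathbf{x})=g(\mathbf{x})+\Psi(\mathbf{x})$ over $\mathbf{x}\in\mathbb{R}^p$, where $\Psi(\mathbf{x})=\sum_{i=1}^N\psi_i(\mathbf{W}_i\mathbf{x}+\mathbf{b}_i)$, each $\psi_i$ is convex (not necessarily differentiable), $\mathbf{W}_i\in\mathbb{R}^{q_i\times p}$, $\mathbf{b}_i\in\mathbb{R}^{q_i}$. Standing assumptions: $f$ is a closed convex function and $\inf\{f(\mathbf{x}):\mathbf{x}\in\mathrm{dom} f\}$ is attained at some $\mathbf{x}^*$; $g:\mathbb{R}^p\to\mathbb{R}$ is closed, proper, convex and continuously differentiable, with $\nabla g$ Lipschitz continuous with constant $L_1$; $\Psi$ is closed, proper and convex. SEP-QN method. Fix $\alpha\in(0,\frac12)$, a backtracking factor $\rho\in(0,1)$ and a history size $M\ge1$. Start with $\mathbf{x}_0\in\mathrm{dom} f$, $\mathbf{H}_0$ a positive multiple of the identity, $\beta=2$, and an empty list of pairs. For $k=0,1,2,\dots$: (1) The symmetric positive definite matrix $\mathbf{H}_k$ used at iteration $k$ is obtained by LBFGS: starting from the current initial Hessian (called $\mathbf{H}_0$ and modified in step (5)), apply successively, for the at most $M$ most recent stored pairs $(\mathbf{s},\mathbf{y})$, the BFGS update $\mathbf{H}_{\rm new}^{-1}=\big(\mathbf{I}-\frac{\mathbf{s}\mathbf{y}^T}{\mathbf{y}^T\mathbf{s}}\big)\mathbf{H}^{-1}\big(\mathbf{I}-\frac{\mathbf{y}\mathbf{s}^T}{\mathbf{y}^T\mathbf{s}}\big)+\frac{\mathbf{s}\mathbf{s}^T}{\mathbf{y}^T\mathbf{s}}$.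 (2) Let $\hat f_k(\mathbf{x})=g(\mathbf{x}_k)+\nabla g(\mathbf{x}_k)^T(\mathbf{x}-\mathbf{x}_k)+\frac12(\mathbf{x}-\mathbf{x}_k)^T\mathbf{H}_k(\mathbf{x}-\mathbf{x}_k)+\Psi(\mathbf{x})$, let $\hat{\mathbf{x}}_k$ be its minimizer, and $\Delta\mathbf{x}_k=\hat{\mathbf{x}}_k-\mathbf{x}_k$. (3) With $\gamma_k=\nabla g(\mathbf{x}_k)^T\Delta\mathbf{x}_k+\Psi(\mathbf{x}_k+\Delta\mathbf{x}_k)-\Psi(\mathbf{x}_k)$, let $t_k$ be the first of $1,\rho,\rho^2,\dots$ for which $f(\mathbf{x}_k+t_k\Delta\mathbf{x}_k)\le f(\mathbf{x}_k)+\alpha t_k\gamma_k$. (4) Set $\mathbf{x}_{k+1}=\mathbf{x}_k+t_k\Delta\mathbf{x}_k$, $\mathbf{s}_k=\mathbf{x}_{k+1}-\mathbf{x}_k$, $\mathbf{y}_k=\nabla g(\mathbf{x}_{k+1})-\nabla g(\mathbf{x}_k)$. (5) If $\mathbf{s}_k^T\mathbf{y}_k>0$: store the pair $(\mathbf{s}_k,\mathbf{y}_k)$ and update the initial Hessian adaptively: if $t_k<1$, replace $\mathbf{H}_0$ by $\mathbf{H}_0/t_k$ and $\beta$ by $\frac{2}{1+1/\beta}$; then (in all cases) replace $\mathbf{H}_0$ by the elementwise minimum of $\mathbf{H}_0/\beta$ and $\frac{\mathbf{y}_k^T\mathbf{y}_k}{\mathbf{y}_k^T\mathbf{s}_k}\mathbf{I}$.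 The method is run without a stopping criterion, producing an infinite sequence. In the theorem, $\{\mathbf{H}_k\}$ denotes the sequence of matrices used in the surrogates $\hat f_k$. SCD (smoothed conic dual) is a first-order method applied to the dual of $\min_{\mathbf{x}}\hat f_k(\mathbf{x})$; continuation SCD is used to obtain the exact minimizer of $\hat f_k$. Dennis–Moré criterion: $\|(\mathbf{H}_k-\nabla^2 g(\mathbf{x}^* ))(\mathbf{x}_{k+1}-\mathbf{x}_k)\|_2=o(\|\mathbf{x}_{k+1}-\mathbf{x}_k\|_2)$ as $k\to\infty$. $\mathbf{A}\preceq\mathbf{B}$ means that $\mathbf{B}-\mathbf{A}$ is positive semidefinite. *)

(* Defs.v *)
From HB Require Import structures.
From mathcomp Require Import all_boot all_order all_algebra.
From mathcomp Require Import all_classical all_reals all_analysis.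
Set Implicit Arguments.
Unset Strict Implicit.
Unset Printing Implicit Defensive.
Import Order.TTheory GRing.Theory Num.Theory.
Import numFieldNormedType.Exports.
Local Open Scope classical_set_scope.
Local Open Scope ring_scope.

(* The library norm on 'cV[R]_p is the max norm.  It is used below only through
   the topology and differentiability it induces, which are those of the
   Euclidean norm; all quantitative estimates use norm2 and opnorm2. *)
Section Euclidean.
Context {R : realType} {p : nat}.
Implicit Types (u v : 'cV[R]_p) (A B : 'M[R]_p).

Definition dotp u v : R := (u^T *m v) 0 0.

Definition norm2 u : R := Num.sqrt (dotp u u).

Definition opnorm2 A : R :=
  sup [set norm2 (A *m v) | v in [set v | norm2 v <= 1]].

Definition psdmx A : Prop := A^T = A /\ forall v, 0 <= dotp v (A *m v).

Definition loewner_le A B : Prop := psdmx (B - A).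

End Euclidean.

Section ExtendedFunctions.
Context {R : realType} {p : nat}.
Implicit Types (F : 'cV[R]_p -> \bar R) (x : 'cV[R]_p).

Definition edom F : set 'cV[R]_p := [set x | (F x < +oo)%E].

Definition epigraph F : set ('cV[R]_p * R^o)%type :=
  [set z | (F z.1 <= z.2%:E)%E].

Definition closed_efun F : Prop := closed (epigraph F).

(* Convexity through the epigraph makes sense whatever the infinite values. *)
Definition convex_efun F : Prop := convex_set (epigraph F).

Definition proper_efun F : Prop := (forall x, (-oo < F x)%E) /\ edom F !=set0.

Definition is_minimizer F x : Prop :=
  edom F x /\ forall z, edom F z -> (F x <= F z)%E.

End ExtendedFunctions.

Section SmoothFunctions.
Context {R : realType} {p : nat}.
Implicit Types (g : 'cV[R]_p -> R) (x : 'cV[R]_p).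

Definition grad g x : 'cV[R]_p := \col_i 'd g x (delta_mx i 0).

Definition hess g x : 'M[R]_p :=
  \matrix_(i, j) 'd (grad g) x (delta_mx j 0) i 0.

Definition cont_diff g : Prop :=
  (forall x, differentiable g x) /\ continuous (grad g).

Definition twice_cont_diff g : Prop :=
  [/\ forall x, differentiable g x, forall x, differentiable (grad g) x
    & continuous (hess g)].

Definition lipschitz_grad (L1 : R) g : Prop :=
  forall x z, norm2 (grad g x - grad g z) <= L1 * norm2 (x - z).

Definition lipschitz_hess (L2 : R) g : Prop :=
  forall x z, opnorm2 (hess g x - hess g z) <= L2 * norm2 (x - z).

Definition strongly_convex (l : R) g : Prop :=
  forall x z (t : R), 0 <= t <= 1 ->
    g (t *: x + (1 - t) *: z) <=
      t * g x + (1 - t) * g z - l / 2 * t * (1 - t) * norm2 (x - z) ^+ 2.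

End SmoothFunctions.

Section Problem.
Context {R : realType} {p : nat}.

(* The psi i take values in \bar R, +oo encoding points outside the domain. *)
Definition nonsmooth_part (N : nat) (q : 'I_N -> nat)
    (W : forall i, 'M[R]_(q i, p)) (b : forall i, 'cV[R]_(q i))
    (psi : forall i, 'cV[R]_(q i) -> \bar R) (x : 'cV[R]_p) : \bar R :=
  (\sum_(i < N) psi i (W i *m x + b i)%R)%E.

Definition objective (g : 'cV[R]_p -> R) (Psi : 'cV[R]_p -> \bar R)
    (x : 'cV[R]_p) : \bar R := ((g x)%:E + Psi x)%E.

End Problem.

Section LBFGS.
Context {R : realType} {p : nat}.
Implicit Types (H : 'M[R]_p) (s y : 'cV[R]_p).

Definition bfgs_update H s y : 'M[R]_p :=
  let r := (dotp y s)^-1 in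
  invmx ((1%:M - r *: (s *m y^T)) *m invmx H *m (1%:M - r *: (y *m s^T))
         + r *: (s *m s^T)).

(* Pairs are listed from the oldest to the most recent. *)
Definition lbfgs (M : nat) H (ps : seq ('cV[R]_p * 'cV[R]_p)) : 'M[R]_p :=
  foldl (fun B sy => bfgs_update B sy.1 sy.2) H (drop (size ps - M) ps).

End LBFGS.

Section SEPQN.
Context {R : realType} {p : nat}.
Variables (g : 'cV[R]_p -> R) (Psi : 'cV[R]_p -> \bar R).

Definition surrogate (xk : 'cV[R]_p) (Hk : 'M[R]_p) (x : 'cV[R]_p) : \bar R :=
  ((g xk + dotp (grad g xk) (x - xk)
    + 2^-1 * dotp (x - xk) (Hk *m (x - xk)))%R%:E + Psi x)%E.

Definition predicted_decrease (xk d : 'cV[R]_p) : \bar R :=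
  ((dotp (grad g xk) d)%:E + Psi (xk + d)%R - Psi xk)%E.

Definition sufficient_decrease (alpha : R) (xk d : 'cV[R]_p) (t : R) : Prop :=
  (objective g Psi (xk + t *: d)%R
     <= objective g Psi xk + (alpha * t)%:E * predicted_decrease xk d)%E.

Definition first_backtrack (alpha rho : R) (xk d : 'cV[R]_p) (t : R) : Prop :=
  exists j : nat,
    [/\ t = rho ^+ j, sufficient_decrease alpha xk d t
      & forall i, (i < j)%N -> ~ sufficient_decrease alpha xk d (rho ^+ i)].

(* Contents of the variables at the start of iteration k, together with the
   surrogate minimizer and the step size computed during iteration k. *)
Record sepqn_trace := SepqnTrace {
  iterate : nat -> 'cV[R]_p ;
  init_hess : nat -> 'M[R]_p ;
  shrink : nat -> R ; (* the factor beta *)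
  pairs : nat -> seq ('cV[R]_p * 'cV[R]_p) ;
  surr_min : nat -> 'cV[R]_p ;
  step : nat -> R
}.

Definition model_hess (M : nat) (T : sepqn_trace) (k : nat) : 'M[R]_p :=
  lbfgs M (init_hess T k) (pairs T k).

Definition sepqn_memory_update (T : sepqn_trace) (k : nat) : Prop :=
  let s := iterate T k.+1 - iterate T k in
  let y := grad g (iterate T k.+1) - grad g (iterate T k) in
  let: (H1, beta1) :=
    if step T k < 1
    then ((step T k)^-1 *: init_hess T k, 2 / (1 + (shrink T k)^-1))
    else (init_hess T k, shrink T k) in
  if 0 < dotp s y then
    [/\ pairs T k.+1 = rcons (pairs T k) (s, y), shrink T k.+1 = beta1
      & init_hess T k.+1 =
          map2_mx Num.min (beta1^-1 *: H1) ((dotp y y / dotp y s)%:M)]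
  else
    [/\ pairs T k.+1 = pairs T k, shrink T k.+1 = shrink T k
      & init_hess T k.+1 = init_hess T k].

(* Every surrogate problem is solved exactly. *)
Record sepqn_run (alpha rho : R) (M : nat) (T : sepqn_trace) : Prop := {
  run_start : edom (objective g Psi) (iterate T 0) ;
  run_init_hess : exists2 h : R, 0 < h & init_hess T 0 = h%:M ;
  run_shrink : shrink T 0 = 2 ;
  run_pairs : pairs T 0 = [::] ;
  run_surr_min : forall k,
    is_minimizer (surrogate (iterate T k) (model_hess M T k)) (surr_min T k) ;
  run_step : forall k,
    first_backtrack alpha rho (iterate T k) (surr_min T k - iterate T k)
      (step T k) ;
  run_iterate : forall k,
    iterate T k.+1 =
      iterate T k + step T k *: (surr_min T k - iterate T k) ;
  run_memory : forall k, sepqn_memory_update T k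
}.

End SEPQN.

Definition dennis_more (R : realType) (p : nat) (g : 'cV[R]_p -> R)
    (xstar : 'cV[R]_p) (H : nat -> 'M[R]_p) (x : nat -> 'cV[R]_p) : Prop :=
  (fun k => norm2 ((H k - hess g xstar) *m (x k.+1 - x k)) : R^o) =o_\oo
  (fun k => norm2 (x k.+1 - x k) : R^o).

Definition superlinear_cvg (R : realType) (p : nat)
    (x : nat -> 'cV[R]_p) (xstar : 'cV[R]_p) : Prop :=
  x @ \oo --> xstar /\
  (fun k => norm2 (x k.+1 - xstar) : R^o) =o_\oo
  (fun k => norm2 (x k - xstar) : R^o).

(* Main.v *)
(* Let x be an iterate, y the minimizer of its surrogate, d = y - x and
   xs the minimizer of f.  Sufficient decrease holds at every step size up to
   (1 - alpha) lH / L1, so the steps are bounded below and f drops by a multiple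
   of |d|^2 at each iteration; hence d -> 0.  Adding the optimality conditions
   of y and of xs cancels Psi, and strong convexity gives
     l |y - xs|^2 <= (y - xs) . (grad g y - grad g x - H d).
   The right-hand side is at most (L1 + LH) |d| |y - xs|, so x -> xs from any
   starting point.  By Taylor expansion and the Dennis-More criterion it is also
   o(|d|) |y - xs|.  A second order expansion of g shows that the unit step is
   eventually accepted since alpha < 1/2, and then y is the next iterate. *)

Require Import Defs.
From HB Require Import structures.
From mathcomp Require Import all_boot all_order all_algebra.
From mathcomp Require Import ring lra.
From mathcomp Require Import all_classical all_reals all_analysis.
Set Implicit Arguments.
Unset Strict Implicit.
Unset Printing Implicit Defensive.
Import Order.TTheory GRing.Theory Num.Theory.
Import numFieldNormedType.Exports.
Local Open Scope classical_set_scope.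
Local Open Scope ring_scope.

(** * Euclidean inner product, Cauchy-Schwarz, operator norm and Loewner bounds *)

Section EuclideanTheory.
Context {R : realType} {p : nat}.
Implicit Types (u v w : 'cV[R]_p) (A B : 'M[R]_p).

Lemma dotpE u v : dotp u v = \sum_i u i 0 * v i 0.
Proof. by rewrite /dotp mxE; apply: eq_bigr => i _; rewrite mxE. Qed.

Lemma dotpC u v : dotp u v = dotp v u.
Proof. by rewrite !dotpE; apply: eq_bigr => i _; rewrite mulrC. Qed.

Lemma dotpDr u v w : dotp u (v + w) = dotp u v + dotp u w.
Proof. by rewrite /dotp mulmxDr mxE. Qed.

Lemma dotpZr (a : R) u v : dotp u (a *: v) = a * dotp u v.
Proof. by rewrite /dotp -scalemxAr mxE. Qed.

Lemma dotpNr u v : dotp u (- v) = - dotp u v.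
Proof. by rewrite -scaleN1r dotpZr mulN1r. Qed.

Lemma dotpBr u v w : dotp u (v - w) = dotp u v - dotp u w.
Proof. by rewrite dotpDr dotpNr. Qed.

Lemma dotpDl u v w : dotp (v + w) u = dotp v u + dotp w u.
Proof. by rewrite dotpC dotpDr !(dotpC u). Qed.

Lemma dotpZl (a : R) u v : dotp (a *: v) u = a * dotp v u.
Proof. by rewrite dotpC dotpZr dotpC. Qed.

Lemma dotpNl u v : dotp (- v) u = - dotp v u.
Proof. by rewrite dotpC dotpNr dotpC. Qed.

Lemma dotpBl u v w : dotp (v - w) u = dotp v u - dotp w u.
Proof. by rewrite dotpDl dotpNl. Qed.

Lemma dotp_ge0 u : 0 <= dotp u u.
Proof. by rewrite dotpE; apply: sumr_ge0 => i _; rewrite -expr2 sqr_ge0. Qed.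

Lemma dotp_mulmx u A v : dotp u (A *m v) = dotp (A^T *m u) v.
Proof. by rewrite /dotp trmx_mul trmxK mulmxA. Qed.

Lemma norm2_ge0 u : 0 <= norm2 u. Proof. exact: sqrtr_ge0. Qed.

Lemma sqr_norm2 u : norm2 u ^+ 2 = dotp u u.
Proof. by rewrite sqr_sqrtr// dotp_ge0. Qed.

Lemma quadratic_ge0_discr (a b c : R) : 0 <= c ->
  (forall t, 0 <= a + t * b *+ 2 + t ^+ 2 * c) -> b ^+ 2 <= a * c.
Proof.
move=> c0 h; have [c_eq0|cN0] := eqVneq c 0.
  have [->|bN0] := eqVneq b 0; first by rewrite c_eq0 mulr0 expr0n.
  suff : 0 <= (-1 : R) by rewrite ler0N1.
  (* For [c = 0] and [b != 0] the polynomial is affine; this is the point where it takes the value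
     [-1]. *)
  apply: le_trans (h (- (a + 1) / (b *+ 2))) _.
  rewrite c_eq0 le_eqVlt; apply/orP; left; apply/eqP; field.
  exact: bN0.
have cgt0 : 0 < c by rewrite lt_neqAle eq_sym cN0.
(* The vertex of the parabola. *)
have /(mulr_ge0 c0) := h (- b / c).
have -> : c * (a + - b / c * b *+ 2 + (- b / c) ^+ 2 * c) = a * c - b ^+ 2.
  by field.
by rewrite subr_ge0.
Qed.

(** The form of [A] at [u + t *: v] is a nonnegative quadratic in [t], so its discriminant is
    nonpositive. It serves with the identity for [dotp_norm2] and with the model Hessian for
    [loewner_le_dotp]. *)
Lemma psdmx_CauchySchwarz A u v : psdmx A ->
  dotp u (A *m v) ^+ 2 <= dotp u (A *m u) * dotp v (A *m v).
Proof.
move=> [Asym Apos]; apply: quadratic_ge0_discr => // t.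
suff -> : dotp u (A *m u) + t * dotp u (A *m v) *+ 2 + t ^+ 2 * dotp v (A *m v)
    = dotp (u + t *: v) (A *m (u + t *: v)) by exact: Apos.
rewrite mulmxDr -scalemxAr !dotpDr !dotpDl !dotpZr !dotpZl.
rewrite [dotp v (A *m u)]dotp_mulmx Asym [dotp (A *m v) u]dotpC.
ring.
Qed.

Lemma dotp_norm2 u v : `|dotp u v| <= norm2 u * norm2 v.
Proof.
have psd1 : psdmx (1%:M : 'M[R]_p).
  by split=> [|w]; rewrite ?trmx1 // mul1mx dotp_ge0.
have := psdmx_CauchySchwarz u v psd1; rewrite !mul1mx -!sqr_norm2 -exprMn.
rewrite -[in X in X -> _](real_normK (num_real (dotp u v))).
by rewrite ler_pXn2r// nnegrE// mulr_ge0// norm2_ge0.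
Qed.

Lemma dotp_le_norm2 u v : dotp u v <= norm2 u * norm2 v.
Proof. exact: le_trans (ler_norm _) (dotp_norm2 u v). Qed.

Lemma norm2D u v : norm2 (u + v) <= norm2 u + norm2 v.
Proof.
have nn := norm2_ge0.
rewrite -(@ler_pXn2r _ 2)// ?nnegrE ?addr_ge0// sqrrD !sqr_norm2.
rewrite dotpDr !dotpDl [dotp v u]dotpC; have := dotp_le_norm2 u v; lra.
Qed.

Lemma norm2Z (a : R) u : norm2 (a *: u) = `|a| * norm2 u.
Proof.
by rewrite /norm2 dotpZr dotpZl mulrA -expr2 sqrtrM ?sqr_ge0// sqrtr_sqr.
Qed.

Lemma norm2N u : norm2 (- u) = norm2 u.
Proof. by rewrite -scaleN1r norm2Z normrN1 mul1r. Qed.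

Lemma norm2B u v : norm2 (u - v) = norm2 (v - u).
Proof. by rewrite -norm2N opprB. Qed.

Lemma norm2_triangle v u w : norm2 (u - w) <= norm2 (u - v) + norm2 (v - w).
Proof. by rewrite -[u - w](subrKA v); apply: norm2D. Qed.

Lemma norm2_entry u i : `|u i 0| <= norm2 u.
Proof.
rewrite -(@ler_pXn2r _ 2)// ?nnegrE ?norm2_ge0// sqr_norm2.
rewrite real_normK ?num_real//.
rewrite dotpE (bigD1 i)//= -expr2 lerDl.
by apply: sumr_ge0 => j _; rewrite -expr2 sqr_ge0.
Qed.

Lemma norm_le_norm2 u : `|u| <= norm2 u.
Proof.
rewrite [leLHS]/Num.norm/= mx_normrE; apply: bigmax_le => [|[i j] _].
  exact: norm2_ge0.
by rewrite ord1 norm2_entry.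
Qed.

Lemma norm2_eq0 u : norm2 u = 0 -> u = 0.
Proof.
by move=> u0; apply/eqP; rewrite -normr_le0 -u0 norm_le_norm2.
Qed.

(** Cauchy-Schwarz on each row bounds the set by the Frobenius norm of [A]; the supremum in
    [opnorm2] is then a genuine one. *)
Lemma opnorm2_has_ubound A :
  has_ubound [set norm2 (A *m v) | v in [set v | norm2 v <= 1]].
Proof.
exists (Num.sqrt (\sum_i dotp (row i A)^T (row i A)^T)) => _ [v v1 <-].
rewrite /norm2 ler_wsqrtr// [leLHS]dotpE; apply: ler_sum => i _.
have -> : (A *m v) i 0 = dotp (row i A)^T v.
  by rewrite /dotp trmxK -row_mul [RHS]mxE.
rewrite -expr2 -[leLHS]real_normK ?num_real//.
rewrite -[leRHS]sqr_norm2 ler_pXn2r// ?nnegrE ?norm2_ge0//.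
rewrite (le_trans (dotp_norm2 _ _))// ler_piMr ?norm2_ge0//.
Qed.

Lemma norm2_mulmx_opnorm2 A v : norm2 (A *m v) <= opnorm2 A * norm2 v.
Proof.
have [v0|vN0] := eqVneq (norm2 v) 0.
  by rewrite v0 mulr0 (norm2_eq0 v0) mulmx0 /norm2 /dotp mulmx0 mxE sqrtr0.
have vgt0 : 0 < norm2 v by rewrite lt_neqAle eq_sym vN0 norm2_ge0.
rewrite -ler_pdivrMr//; apply: sup_upper_bound.
  split; last exact: opnorm2_has_ubound.
  by exists (norm2 (A *m 0)), 0 => //=; rewrite /norm2 /dotp mulmx0 mxE sqrtr0.
have nZ w : norm2 ((norm2 v)^-1 *: w) = norm2 w / norm2 v.
  by rewrite norm2Z ger0_norm ?invr_ge0 ?norm2_ge0// mulrC.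
exists ((norm2 v)^-1 *: v) => /=; last by rewrite -scalemxAr nZ.
by rewrite nZ divff.
Qed.

Lemma loewner_le_scalarl (c : R) A v : loewner_le c%:M A ->
  c * norm2 v ^+ 2 <= dotp v (A *m v).
Proof.
move=> [_ /(_ v)]; rewrite mulmxBl dotpBr mul_scalar_mx dotpZr sqr_norm2.
by rewrite subr_ge0.
Qed.

Lemma loewner_le_scalarr (c : R) A v : loewner_le A c%:M ->
  dotp v (A *m v) <= c * norm2 v ^+ 2.
Proof.
move=> [_ /(_ v)]; rewrite mulmxBl dotpBr mul_scalar_mx dotpZr sqr_norm2.
by rewrite subr_ge0.
Qed.

(** Cauchy-Schwarz for the semi-inner product of [A] reduces the mixed term to two diagonal ones, so
    no spectral decomposition enters. *)
Lemma loewner_le_dotp (c C : R) A u v : 0 <= c -> 0 <= C ->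
  loewner_le c%:M A -> loewner_le A C%:M ->
  dotp u (A *m v) <= C * norm2 u * norm2 v.
Proof.
move=> c0 C0 cA AC; have psdA : psdmx A.
  split; last first.
    move=> w; apply: le_trans (loewner_le_scalarl w cA).
    by rewrite mulr_ge0// sqr_ge0.
  (* Symmetry of [A] is read off the symmetry of [A - c%:M]. *)
  by case: cA => + _; rewrite linearB/= tr_scalar_mx => /addIr.
apply: le_trans (ler_norm _) _.
rewrite -(@ler_pXn2r _ 2)// ?nnegrE ?mulr_ge0 ?norm2_ge0//.
rewrite real_normK ?num_real//.
apply: le_trans (psdmx_CauchySchwarz u v psdA) _.
have -> : (C * norm2 u * norm2 v) ^+ 2 =
  (C * norm2 u ^+ 2) * (C * norm2 v ^+ 2) by ring.
by apply: ler_pM; rewrite ?loewner_le_scalarr//; apply: (psdA.2).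
Qed.

End EuclideanTheory.

(** * Derivatives along lines and the mean value theorem on the unit interval *)

Section SmoothTheory.
Context {R : realType} {p : nat}.
Implicit Types (g : 'cV[R]_p -> R) (x z u v d : 'cV[R]_p) (t : R).

Lemma is_derive_line (V : normedModType R) (F : 'cV[R]_p -> V) x v t :
  differentiable F (x + t *: v) ->
  is_derive t (1 : R) (fun s : R => F (x + s *: v)) ('d F (x + t *: v) v).
Proof.
move=> dF.
have lineP : is_diff t (fun s : R => x + s *: v) (fun s : R => s *: v).
  have -> : (fun s : R => x + s *: v) = cst x + *:%R^~ v by [].
  rewrite -[X in is_diff _ _ X]add0r.
  exact: (is_diffD (is_diff_cst x t) (is_diff_scalel t v)).
have FP : is_diff (x + t *: v) F ('d F (x + t *: v)) by split.
have cP := is_diff_comp lineP FP.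
have -> : (fun s : R => F (x + s *: v)) = F \o (fun s : R => x + s *: v) by [].
apply: DeriveDef; first exact/diff_derivable/ex_diff.
by rewrite deriveE ?diff_val/= ?scale1r//; exact: ex_diff.
Qed.

Lemma cVE v : v = \sum_i v i 0 *: (delta_mx i 0 : 'cV[R]_p).
Proof.
by rewrite [LHS]matrix_sum_delta; apply: eq_bigr => i _; rewrite big_ord1.
Qed.

Lemma diff_grad g x v : 'd g x v = dotp (grad g x) v.
Proof.
rewrite {1}(cVE v) linear_sum/= dotpE; apply: eq_bigr => i _.
by rewrite linearZ/= mxE mulrC.
Qed.

Lemma diff_hess g x v : 'd (grad g) x v = hess g x *m v.
Proof.
apply/matrixP => i j; rewrite ord1 {1}(cVE v) linear_sum/= summxE mxE.
by apply: eq_bigr => k _; rewrite linearZ/= !mxE mulrC.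
Qed.

Lemma is_derive_grad g x v t : differentiable g (x + t *: v) ->
  is_derive t (1 : R) (fun s : R => g (x + s *: v))
    (dotp (grad g (x + t *: v)) v).
Proof. by move=> /is_derive_line; rewrite diff_grad. Qed.

Lemma differentiable_dotp u x : differentiable (dotp u) x.
Proof.
have -> : dotp u = \sum_i (u i 0 *: (fun z : 'cV[R]_p => z i 0 : R)).
  by apply/funext => z; rewrite dotpE fct_sumE.
apply: differentiable_sum => i.
exact/differentiableZ/differentiable_coord.
Qed.

(** Pairing the gradient with a fixed [u] gives a scalar function, to which the mean value theorem
    applies as an equality. *)
Lemma is_derive_hess g x u v t : differentiable (grad g) (x + t *: v) ->
  is_derive t (1 : R) (fun s : R => dotp u (grad g (x + s *: v)))
    (dotp u (hess g (x + t *: v) *m v)).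
Proof.
move=> dg; have du y : is_diff y (dotp u) (dotp u).
  split; first exact: differentiable_dotp.
  (* Packed as a continuous linear map, [dotp u] is its own differential. *)
  have ul : linear (dotp u) by move=> a w z; rewrite dotpDr dotpZr.
  pose ulM := GRing.isLinear.Build _ _ _ _ _ ul.
  pose uL : {linear _ -> _} := HB.pack (dotp u) ulM.
  apply: (@diff_lin _ _ _ uL) => w.
  exact/differentiable_continuous/differentiable_dotp.
have gP : is_diff (x + t *: v) (grad g) ('d (grad g) (x + t *: v)) by split.
have := @is_derive_line _ (dotp u \o grad g) x v t.
have cP := is_diff_comp gP (du _).
by rewrite diff_val/= diff_hess; apply; exact: ex_diff.
Qed.

Lemma MVT01 (F dF : R -> R) : (forall t, is_derive t (1 : R) F (dF t)) ->
  exists2 t, 0 <= t <= 1 & F 1 - F 0 = dF t.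
Proof.
move=> FP; have cF : {within `[0, 1], continuous F}.
  apply: continuous_subspaceT => t.
  apply/differentiable_continuous/derivable1_diffP.
  exact: ex_derive.
have [t] := MVT_segment ler01 (fun t _ => FP t) cF.
by rewrite in_itv/= subr0 mulr1 => t01 ->; exists t.
Qed.

End SmoothTheory.

(** * Taylor estimates from Lipschitz derivatives, and strong convexity *)

Section SmoothInequalities.
Context {R : realType} {p : nat}.
Implicit Types (g : 'cV[R]_p -> R) (x z u v d : 'cV[R]_p) (t : R).

(** Division by [t] followed by [t -> 0], in a form without limits; every first-order condition
    below comes from it. *)
Lemma le_first_order (A B C : R) :
  (forall t, 0 < t <= 1 -> t * A <= t * B + t ^+ 2 * C) -> A <= B.
Proof.
move=> h; rewrite leNgt; apply/negP => BA.
have D0 : 0 < A - B by rewrite subr_gt0.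
have C0 := normr_ge0 C; have CC := ler_norm C.
have E0 : 0 < A - B + `|C| + 1 by lra.
(* If [B < A], this [t] lies in the unit interval and makes the product of [t] and the absolute
   value of [C] smaller than [A - B]. *)
set t := (A - B) / (A - B + `|C| + 1).
have t0 : 0 < t by rewrite divr_gt0.
have t1 : t <= 1 by rewrite ler_pdivrMr//; lra.
have tE : t * (A - B + `|C| + 1) = A - B by rewrite mulfVK// gt_eqF.
have := h t; rewrite t0 t1 => /(_ isT).
have -> : t * B + t ^+ 2 * C = t * (B + t * C) by ring.
rewrite ler_pM2l// => h1.
have : t * C <= t * `|C| by rewrite ler_pM2l.
have := mulr_gt0 t0 D0; nra.
Qed.

(** The mean value theorem replaces the difference of [g] by a gradient at an intermediate point.
    This gives the constant [L1] in place of [L1 / 2]; the absolute value covers any sign of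
    [L1]. *)
Lemma gradient_lipschitz_taylor g (L1 : R) x d :
  (forall x, differentiable g x) -> lipschitz_grad L1 g ->
  `|g (x + d) - g x - dotp (grad g x) d| <= `|L1| * norm2 d ^+ 2.
Proof.
move=> dg gL.
have [t /andP[t0 t1]] := MVT01 (fun t => is_derive_grad (dg (x + t *: d))).
rewrite scale1r scale0r addr0 => ->; rewrite -dotpBl.
apply: le_trans (dotp_norm2 _ _) _.
rewrite expr2 mulrA ler_wpM2r ?norm2_ge0//.
apply: le_trans (gL _ _) _.
rewrite addrC addKr norm2Z (ger0_norm t0).
apply: (@le_trans _ _ (`|L1| * (t * norm2 d))).
  by rewrite ler_wpM2r ?ler_norm// mulr_ge0// norm2_ge0.
by rewrite ler_wpM2l// ler_piMl// norm2_ge0.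
Qed.

(** In the strong convexity inequality at parameter [t], the value at [x + t *: d] is bounded below
    by its linearization; all errors are of order [t ^+ 2]. *)
Lemma strongly_convex_lower g (l L1 : R) x d :
  (forall x, differentiable g x) -> lipschitz_grad L1 g ->
  strongly_convex l g ->
  dotp (grad g x) d + l / 2 * norm2 d ^+ 2 <= g (x + d) - g x.
Proof.
move=> dg gL gl.
apply: (@le_first_order _ _ ((`|L1| + l / 2) * norm2 d ^+ 2)) => t /andP[t0 t1].
have := gl (x + d) x t; rewrite ltW//= t1 => /(_ isT).
have -> : t *: (x + d) + (1 - t) *: x = x + t *: d.
  by rewrite scalerDr addrAC -scalerDl addrC subrKC scale1r addrC.
rewrite [x + d]addrC addrK [d + x]addrC.
have := gradient_lipschitz_taylor x (t *: d) dg gL.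
rewrite norm2Z dotpZr ler_norml => /andP[+ _]; rewrite (gtr0_norm t0); nra.
Qed.

(** Sum of the quadratic lower bounds based at [x] and at [z]. *)
Lemma strongly_convex_monotone g (l L1 : R) x z :
  (forall x, differentiable g x) -> lipschitz_grad L1 g ->
  strongly_convex l g ->
  l * norm2 (z - x) ^+ 2 <= dotp (grad g z - grad g x) (z - x).
Proof.
move=> dg gL gl.
have := strongly_convex_lower x (z - x) dg gL gl.
have := strongly_convex_lower z (x - z) dg gL gl.
rewrite (subrKC x z) (subrKC z x) (norm2B x z) -(opprB z x).
move: (grad g x) (grad g z) (z - x) => a b d.
rewrite dotpNr dotpBl; lra.
Qed.

(** The gradient difference is a Hessian at a point of the segment, which is at distance at most
    [norm2 (x - xs) + norm2 v] from [xs]. *)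
Lemma hessian_lipschitz_gradient g (L2 : R) xs x u v :
  (forall x, differentiable (grad g) x) -> lipschitz_hess L2 g ->
  dotp u (grad g (x + v) - grad g x - hess g xs *m v) <=
    `|L2| * (norm2 (x - xs) + norm2 v) * norm2 u * norm2 v.
Proof.
move=> dg hL.
have [t /andP[t0 t1]] :=
  MVT01 (fun t => is_derive_hess u (dg (x + t *: v))).
rewrite scale1r scale0r addr0 => e.
rewrite 2!dotpBr e -dotpBr -mulmxBl.
apply: le_trans (dotp_le_norm2 _ _) _.
rewrite [X in _ <= X * _]mulrC -mulrA ler_wpM2l ?norm2_ge0//.
apply: le_trans (norm2_mulmx_opnorm2 _ _) _.
rewrite ler_wpM2r ?norm2_ge0//.
apply: le_trans (hL _ _) _.
apply: (@le_trans _ _ (`|L2| * norm2 (x + t *: v - xs))).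
  by rewrite ler_wpM2r ?ler_norm// norm2_ge0.
rewrite ler_wpM2l// addrAC.
apply: le_trans (norm2D _ _) _.
by rewrite lerD2l norm2Z ger0_norm// ler_piMl// norm2_ge0.
Qed.

Lemma hessian_lipschitz_taylor g (L2 : R) xs x d :
  (forall x, differentiable g x) -> (forall x, differentiable (grad g) x) ->
  lipschitz_hess L2 g ->
  g (x + d) - g x - dotp (grad g x) d - 2^-1 * dotp d (hess g xs *m d) <=
    `|L2| * (norm2 (x - xs) + norm2 d) * norm2 d ^+ 2.
Proof.
move=> dg dgg hL.
set a := dotp (grad g x) d; set q := dotp d (hess g xs *m d).
(* The increment of [F] over the unit interval is the remainder sought, and its derivative at [t] is
   the quantity bounded in [hessian_lipschitz_gradient] with [u = d] and [v = t *: d]. *)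
pose F t := g (x + t *: d) - t * a - 2^-1 * t ^+ 2 * q.
have dF t : is_derive t (1 : R) F (dotp (grad g (x + t *: d)) d - a - t * q).
  have dt := is_derive_grad (dg (x + t *: d)).
  have -> : F = (fun t => g (x + t *: d)) - a *: id - (2^-1 * q) *: (id ^+ 2).
    apply/funext => s; rewrite /F.
    by transitivity (g (x + s *: d) - a * s - 2^-1 * q * s ^+ 2); [ring|].
  by apply: is_derive_eq; rewrite /GRing.scale/=; field.
have [t /andP[t0 t1]] := MVT01 dF; rewrite /F scale1r scale0r addr0.
have -> : g (x + d) - 1 * a - 2^-1 * 1 ^+ 2 * q -
   (g x - 0 * a - 2^-1 * 0 ^+ 2 * q) = g (x + d) - g x - a - 2^-1 * q by ring.
move=> ->.
have := hessian_lipschitz_gradient xs x d (t *: d) dgg hL.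
have -> : dotp d (grad g (x + t *: d) - grad g x - hess g xs *m (t *: d)) =
    dotp (grad g (x + t *: d)) d - a - t * q.
  rewrite /a /q; move: (grad g x) (grad g _) (hess g xs) => u v A.
  by rewrite dotpBr dotpBr -scalemxAr dotpZr (dotpC u) (dotpC v).
rewrite norm2Z (ger0_norm t0) => /le_trans; apply.
have nd := norm2_ge0 d.
have td : t * norm2 d <= norm2 d by rewrite ler_piMl.
rewrite -!mulrA expr2 ler_wpM2l//.
rewrite ler_pM ?addr_ge0 ?mulr_ge0 ?norm2_ge0//; first by rewrite lerD2l.
by rewrite ler_wpM2l.
Qed.

End SmoothInequalities.

(** * Extended-valued convexity and first-order optimality of composite functions *)

Section CompositeTheory.
Context {R : realType} {p : nat}.
Implicit Types (g : 'cV[R]_p -> R) (Psi : 'cV[R]_p -> \bar R).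
Implicit Types (x z d : 'cV[R]_p) (t : R).

Lemma edom_fin Psi x : (forall z, -oo < Psi z)%E -> edom Psi x ->
  Psi x = (fine (Psi x))%:E.
Proof.
by move=> Psi_gt Psix; rewrite fineK// fin_real// Psi_gt.
Qed.

Lemma edom_EFinD g Psi x :
  edom (fun z => (g z)%:E + Psi z)%E x <-> edom Psi x.
Proof. by rewrite /edom/=; case: (Psi x) => [r| |] //=; rewrite !ltry. Qed.

Lemma convex_efun_segment Psi x z t : (forall y, -oo < Psi y)%E ->
  convex_efun Psi -> edom Psi x -> edom Psi z -> 0 <= t <= 1 ->
  edom Psi (x + t *: (z - x)) /\
  fine (Psi (x + t *: (z - x))) <=
    fine (Psi x) + t * (fine (Psi z) - fine (Psi x)).
Proof.
move=> Psi_gt Psi_cvx xD zD /andP[t0 t1].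
have -> : x + t *: (z - x) = t *: z + (1 - t) *: x.
  by rewrite scalerBr scalerBl scale1r addrCA addrA.
have epi y : edom Psi y -> (y, fine (Psi y)) \in epigraph Psi.
  by move=> yD; apply/mem_set; rewrite /epigraph/= -edom_fin.
have /set_mem := Psi_cvx _ _ (Itv01 t0 t1) (epi _ zD) (epi _ xD).
rewrite /epigraph/= => le_Psi.
(* The convex combination of pairs is computed componentwise by conversion. *)
have {}le_Psi : (Psi (t *: z + (1 - t) *: x)%R <=
    (t * fine (Psi z) + (1 - t) * fine (Psi x))%R%:E)%E := le_Psi.
have tD : edom Psi (t *: z + (1 - t) *: x).
  exact: le_lt_trans le_Psi (ltry _).
split=> //; move: le_Psi; rewrite (edom_fin Psi_gt tD) lee_fin.
by move=> /le_trans; apply; lra.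
Qed.

(** Moving from [x] towards [z] by [t] changes [Psi] by at most [t] times its total change. Asking
    only for a first-order upper model of the smooth part lets one lemma treat both the objective
    and the surrogate. *)
Lemma minimizer_first_order g Psi x z (a C : R) :
  (forall y, -oo < Psi y)%E -> convex_efun Psi ->
  is_minimizer (fun y => (g y)%:E + Psi y)%E x -> edom Psi z ->
  (forall t, 0 < t <= 1 -> g (x + t *: (z - x)) <= g x + t * a + t ^+ 2 * C) ->
  0 <= a + fine (Psi z) - fine (Psi x).
Proof.
move=> Psi_gt Psi_cvx [/edom_EFinD xD xmin] zD gle.
suff : fine (Psi x) - fine (Psi z) <= a by lra.
apply: (@le_first_order _ _ _ C) => t t01; have /andP[t0 t1] := t01.
have t01' : 0 <= t <= 1 by rewrite (ltW t0).
have [tD le_Psi] := convex_efun_segment Psi_gt Psi_cvx xD zD t01'.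
have /edom_EFinD-/(_ g)/xmin := tD.
rewrite (edom_fin Psi_gt xD) (edom_fin Psi_gt tD) -!EFinD lee_fin.
have := gle _ t01; lra.
Qed.

Lemma objective_variational g Psi (L1 : R) x z :
  (forall y, differentiable g y) -> lipschitz_grad L1 g ->
  (forall y, -oo < Psi y)%E -> convex_efun Psi ->
  is_minimizer (objective g Psi) x -> edom Psi z ->
  0 <= dotp (grad g x) (z - x) + fine (Psi z) - fine (Psi x).
Proof.
move=> dg gL Psi_gt Psi_cvx xmin zD.
apply: (@minimizer_first_order g _ _ _ _ (`|L1| * norm2 (z - x) ^+ 2)
  Psi_gt) => // t /andP[t0 t1].
have := gradient_lipschitz_taylor x (t *: (z - x)) dg gL.
rewrite ler_norml => /andP[_].
move: (grad g x) (z - x) => u d.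
rewrite dotpZr norm2Z (gtr0_norm t0) exprMn; lra.
Qed.

Lemma surrogate_variational g Psi x (H : 'M[R]_p) y z : H^T = H ->
  (forall w, -oo < Psi w)%E -> convex_efun Psi ->
  is_minimizer (surrogate g Psi x H) y -> edom Psi z ->
  0 <= dotp (grad g x + H *m (y - x)) (z - y) + fine (Psi z) - fine (Psi y).
Proof.
move=> Hsym Psi_gt Psi_cvx ymin zD.
apply: (@minimizer_first_order _ _ _ _ _
  (2^-1 * dotp (z - y) (H *m (z - y))) Psi_gt Psi_cvx ymin) => // t _.
move: (grad g x) => u; rewrite (addrAC y).
move: (y - x) (z - y) => d w.
rewrite !(mulmxDr, dotpDr, dotpDl) -!scalemxAr !dotpZr !dotpZl.
rewrite (dotp_mulmx d H w) Hsym [dotp w (H *m d)]dotpC.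
by rewrite le_eqVlt; apply/orP; left; apply/eqP; field.
Qed.

Lemma sufficient_decreaseE g Psi (alpha : R) x d t :
  (forall y, -oo < Psi y)%E -> edom Psi x -> edom Psi (x + d) ->
  edom Psi (x + t *: d) ->
  sufficient_decrease g Psi alpha x d t <->
  g (x + t *: d) + fine (Psi (x + t *: d)) <= g x + fine (Psi x) +
    alpha * t * (dotp (grad g x) d + fine (Psi (x + d)) - fine (Psi x)).
Proof.
move=> Psi_gt xD dD tD; rewrite /sufficient_decrease /objective.
rewrite /predicted_decrease.
by rewrite (edom_fin Psi_gt xD) (edom_fin Psi_gt dD) (edom_fin Psi_gt tD).
Qed.

End CompositeTheory.

(** Lower bound for the backtracked step: the acceptance threshold shrunk once by [rho]. The added
    [1] keeps the denominator positive when [L1 = 0]. *)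
Definition step_bound (R : realType) (L1 alpha rho lH : R) : R :=
  Num.min 1 (rho * ((1 - alpha) * lH) / (`|L1| + 1)).

Lemma step_bound_gt0 (R : realType) (L1 alpha rho lH : R) :
  0 < alpha < 1 / 2 -> 0 < rho < 1 -> 0 < lH ->
  0 < step_bound L1 alpha rho lH.
Proof.
move=> /andP[al0 al1] /andP[r0 r1] lH0.
rewrite lt_min ltr01/= divr_gt0 ?mulr_gt0//; lra.
Qed.

(** * One iteration: step size, decrease and error of the surrogate minimizer *)

Section OneIteration.
Context {R : realType} {p : nat} (g : 'cV[R]_p -> R) (Psi : 'cV[R]_p -> \bar R).
Context (xs : 'cV[R]_p) (L1 L2 l alpha rho lH LH : R).
Hypotheses (Psi_gt : forall y, (-oo < Psi y)%E) (Psi_cvx : convex_efun Psi).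
Hypothesis xs_min : is_minimizer (objective g Psi) xs.
Hypotheses (dg : forall y, differentiable g y) (gL : lipschitz_grad L1 g).
Hypothesis gl : strongly_convex l g.
Hypotheses (alpha01 : 0 < alpha < 1 / 2) (rho01 : 0 < rho < 1).
Hypothesis lH_gt0 : 0 < lH.
Context (x y : 'cV[R]_p) (H : 'M[R]_p) (t : R).
Hypotheses (lH_le : loewner_le lH%:M H) (H_le : loewner_le H LH%:M).
Hypotheses (xD : edom Psi x) (y_min : is_minimizer (surrogate g Psi x H) y).
Hypothesis t_first : first_backtrack g Psi alpha rho x (y - x) t.

Let d := y - x.
Let gam := dotp (grad g x) d + fine (Psi y) - fine (Psi x).
Let xsD : edom Psi xs. Proof. by case: xs_min => /edom_EFinD. Qed.

Lemma surr_min_edom : edom Psi y. Proof. by case: y_min => /edom_EFinD. Qed.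

Let Hsym : H^T = H.
Proof. by case: lH_le => + _; rewrite linearB/= tr_scalar_mx => /addIr. Qed.

Lemma first_backtrack_gt0 : 0 < t <= 1.
Proof.
have /andP[r0 r1] := rho01; have [j [-> _ _]] := t_first.
by rewrite exprn_gt0// exprn_ile1// ltW.
Qed.

Let segD s : 0 <= s <= 1 -> edom Psi (x + s *: d).
Proof.
by move=> s01; case: (convex_efun_segment Psi_gt Psi_cvx xD surr_min_edom s01).
Qed.

Lemma next_edom : edom Psi (x + t *: d).
Proof. by apply: segD; have /andP[/ltW -> ->] := first_backtrack_gt0. Qed.

(** Optimality of [y] for the surrogate, tested at [x]. *)
Lemma predicted_decrease_le : gam <= - dotp d (H *m d).
Proof.
have := surrogate_variational Hsym Psi_gt Psi_cvx y_min xD.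
rewrite -(opprB y x) -/d /gam.
move: (grad g x) => u; rewrite dotpNr dotpDl (dotpC (H *m d)); lra.
Qed.

Lemma predicted_decrease_le_norm2 : gam <= - (lH * norm2 d ^+ 2).
Proof.
have := predicted_decrease_le; have := loewner_le_scalarl d lH_le; lra.
Qed.

Let sufficientP s : 0 <= s <= 1 ->
  sufficient_decrease g Psi alpha x d s <->
  g (x + s *: d) + fine (Psi (x + s *: d)) <=
    g x + fine (Psi x) + alpha * s * gam.
Proof.
move=> /segD; have := @sufficient_decreaseE _ _ g Psi alpha x d s Psi_gt xD.
by rewrite /gam /d subrKC => h; apply: h; exact: surr_min_edom.
Qed.

(** Convexity of [Psi] and the Taylor bound on [g] give a change of at most [s * gam] plus an error
    quadratic in [s]. The slack [(1 - alpha) * s * - gam], at least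
    [(1 - alpha) * s * lH * norm2 d ^+ 2], absorbs that error. *)
Let sufficient_small s : 0 <= s <= 1 ->
  s * `|L1| <= (1 - alpha) * lH -> sufficient_decrease g Psi alpha x d s.
Proof.
move=> s01 sL; apply/sufficientP => //; have /andP[s0 s1] := s01.
have [_] := convex_efun_segment Psi_gt Psi_cvx xD surr_min_edom s01.
have := gradient_lipschitz_taylor x (s *: d) dg gL.
rewrite ler_norml => /andP[_]; rewrite -/d dotpZr norm2Z (ger0_norm s0) exprMn.
have := predicted_decrease_le_norm2; rewrite /gam.
set a := dotp _ _; set n := norm2 d ^+ 2.
set f1 := fine (Psi y); set f0 := fine (Psi x); set f2 := fine (Psi (x + _)).
set g0 := g x; set g1 := g (x + _).
have n0 : 0 <= n by exact: sqr_ge0.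
have /andP[al0 al1] := alpha01.
move=> gle h1 h2.
have k1 : 0 <= (1 - alpha) * s * - (a + f1 - f0 + lH * n).
  apply: mulr_ge0; last by lra.
  by apply: mulr_ge0 => //; lra.
have k2 : s * n * (s * `|L1|) <= s * n * ((1 - alpha) * lH).
  by apply: ler_wpM2l => //; apply: mulr_ge0.
lra.
Qed.

Let tau := step_bound L1 alpha rho lH.

Lemma backtrack_ge : tau <= t.
Proof.
have /andP[r0 r1] := rho01; have /andP[al0 al1] := alpha01.
(* Either the first trial [1] is accepted, or the preceding trial [rho ^+ j] was rejected and so
   exceeds the threshold of [sufficient_small]. *)
have [[|j] [-> _ jmin]] := t_first; rewrite /tau /step_bound ge_min.
  by rewrite expr0 lexx.
apply/orP; right.
have L0 := normr_ge0 L1.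
rewrite ler_pdivrMr; last by lra.
rewrite exprS -mulrA ler_wpM2l ?(ltW r0)// leNgt; apply/negP => small.
apply: (jmin j (leqnn _)); apply: sufficient_small.
  by rewrite exprn_ge0 ?(ltW r0)//= exprn_ile1// ltW.
apply: le_trans (ltW small).
by rewrite ler_wpM2l ?exprn_ge0 ?(ltW r0)//; lra.
Qed.

Lemma objective_decrease :
  g (x + t *: d) + fine (Psi (x + t *: d)) <=
    g x + fine (Psi x) - alpha * step_bound L1 alpha rho lH * lH * norm2 d ^+ 2.
Proof.
have [j [tE tdec _]] := t_first.
have /andP[t0 t1] := first_backtrack_gt0.
have t01 : 0 <= t <= 1 by rewrite ltW.
have /(sufficientP t01) := tdec.
move=> /le_trans; apply; rewrite -addrA -[leRHS]addrA lerD2l lerD2l.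
have /andP[al0 al1] := alpha01.
apply: (@le_trans _ _ (alpha * t * - (lH * norm2 d ^+ 2))).
  rewrite ler_wpM2l ?predicted_decrease_le_norm2//.
  by apply: mulr_ge0 => //; exact: ltW.
rewrite -/tau mulrN lerN2 -!mulrA ler_wpM2l ?(ltW al0)//.
by rewrite ler_wpM2r ?backtrack_ge// mulr_ge0 ?sqr_ge0 ?ltW.
Qed.

(* Adding the optimality conditions of [y] (tested at [xs]) and of [xs] (tested
   at [y]) cancels [Psi]. *)
Let error_dotp : l * norm2 (y - xs) ^+ 2 <=
  dotp (y - xs) (grad g y - grad g x - H *m d).
Proof.
have := strongly_convex_monotone xs y dg gL gl.
have := surrogate_variational Hsym Psi_gt Psi_cvx y_min xsD.
have := objective_variational dg gL Psi_gt Psi_cvx xs_min surr_min_edom.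
rewrite -/d -(opprB y xs); move: (grad g x) (grad g xs) (grad g y) => u v w.
move: (y - xs) (H *m d) => e b.
rewrite !dotpBr dotpNr !dotpDl dotpNl (dotpC e u) (dotpC e w) (dotpC e b); lra.
Qed.

(** Cauchy-Schwarz on both terms of [error_dotp], then division by [norm2 (y - xs)]. This crude
    bound already yields convergence. *)
Lemma error_le_direction : 0 <= LH ->
  l * norm2 (y - xs) <= (`|L1| + LH) * norm2 d.
Proof.
move=> LH0; have [e0|eN0] := eqVneq (norm2 (y - xs)) 0.
  by rewrite e0 mulr0 mulr_ge0 ?addr_ge0 ?norm2_ge0.
have e0 : 0 < norm2 (y - xs) by rewrite lt_neqAle eq_sym eN0 norm2_ge0.
rewrite -(ler_pM2r e0) -[leLHS]mulrA -expr2.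
apply: le_trans error_dotp _.
have := dotp_le_norm2 (y - xs) (grad g y - grad g x).
have := loewner_le_dotp (- (y - xs)) d (ltW lH_gt0) LH0 lH_le H_le.
have : norm2 (grad g y - grad g x) <= `|L1| * norm2 d.
  by apply: le_trans (gL _ _) _; rewrite ler_wpM2r ?ler_norm ?norm2_ge0.
move: (grad g y) (grad g x) => u v.
rewrite dotpNl norm2N dotpBr mulrDl => h1 h2 h3.
have h4 : norm2 (y - xs) * norm2 (u - v) <= norm2 (y - xs) * (`|L1| * norm2 d).
  by rewrite ler_wpM2l// norm2_ge0.
rewrite !dotpBr; lra.
Qed.

Hypotheses (dgg : forall z, differentiable (grad g) z).
Hypothesis hL : lipschitz_hess L2 g.
Let A := hess g xs.

(** In [error_dotp], [H *m d] is split as [A *m d + (H - A) *m d]: the first part is compared with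
    the gradient difference, the second is the Dennis-More term. *)
Lemma error_le_model : l * norm2 (y - xs) <=
  `|L2| * (norm2 (x - xs) + norm2 d) * norm2 d + norm2 ((H - A) *m d).
Proof.
have [e0|eN0] := eqVneq (norm2 (y - xs)) 0.
  rewrite e0 mulr0 addr_ge0 ?norm2_ge0// mulr_ge0 ?norm2_ge0//.
  by rewrite mulr_ge0// addr_ge0 ?norm2_ge0.
have e0 : 0 < norm2 (y - xs) by rewrite lt_neqAle eq_sym eN0 norm2_ge0.
rewrite -(ler_pM2r e0) -[leLHS]mulrA -expr2.
apply: le_trans error_dotp _.
have := hessian_lipschitz_gradient xs x (y - xs) d dgg hL.
have := dotp_le_norm2 (- (y - xs)) ((H - A) *m d).
rewrite {2}/d subrKC -/A; move: (grad g y) (grad g x) A => u v B.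
rewrite dotpNl norm2N mulmxBl !dotpBr; lra.
Qed.

(** Expanding [g] to second order, the objective changes by at most [gam + dotp d (H *m d) / 2] plus
    the errors on the left, hence by at most [gam / 2] plus these errors. Since [- gam] is at least
    [lH * norm2 d ^+ 2], the total stays below [alpha * gam]. *)
Lemma unit_step :
  `|L2| * (norm2 (x - xs) + norm2 d) * norm2 d ^+ 2
    + 2^-1 * (norm2 d * norm2 ((H - A) *m d))
    <= (1 / 2 - alpha) * (lH * norm2 d ^+ 2) -> t = 1.
Proof.
move=> small.
suff : sufficient_decrease g Psi alpha x d (rho ^+ 0).
  by have [[|j] [-> _ jmin]] := t_first; [|move=> /(jmin 0%N (ltn0Sn _))].
rewrite expr0; apply/sufficientP; first by rewrite ler01 lexx.
rewrite scale1r mulr1; have /andP[al0 al1] := alpha01.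
have := hessian_lipschitz_taylor xs x d dg dgg hL.
have := dotp_le_norm2 d (- ((H - A) *m d)).
have := predicted_decrease_le; have := predicted_decrease_le_norm2.
have xd : x + d = y by rewrite /d subrKC.
move: small; rewrite -/A norm2N /gam xd mulmxBl; move: A => B.
rewrite dotpNr (dotpBr d).
set a := dotp (grad g x) d; set n := norm2 d ^+ 2.
set f1 := fine (Psi y); set f0 := fine (Psi x).
move=> h1 h2 h3 h4 h5.
have k : (1 / 2 - alpha) * (lH * n) <= (1 / 2 - alpha) * - (a + f1 - f0).
  by apply: ler_wpM2l; lra.
lra.
Qed.

End OneIteration.

(** [F] is nonincreasing and bounded below, hence convergent; its consecutive gaps tend to zero and
    dominate [a]. *)
Lemma decrease_cvg0 (R : realType) (F a : nat -> R) (m : R) :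
  (forall k, m <= F k) -> (forall k, 0 <= a k) ->
  (forall k, F k.+1 <= F k - a k) -> a @ \oo --> 0.
Proof.
move=> Fm a0 Fdec.
have Fni : nonincreasing_seq F.
  by apply/nonincreasing_seqP => k; have := Fdec k; have := a0 k; lra.
have Fcvg : cvgn F.
  by apply: nonincreasing_is_cvgn => //; exists m => _ [k _ <-].
have Dcvg : (fun k => F k - F k.+1) @ \oo --> (0 : R).
  rewrite -(subrr (limn F)); apply: cvgB => //.
  by rewrite (cvg_shiftS F).
apply: (@squeeze_cvgr _ _ _ _ (cst 0) (fun k => F k - F k.+1)) => //.
  by apply: nearW => k; rewrite /= a0 /=; have := Fdec k; lra.
exact: cvg_cst.
Qed.

(** * Asymptotics of a whole run *)

Section Run.
Context {R : realType} {p : nat} (g : 'cV[R]_p -> R) (Psi : 'cV[R]_p -> \bar R).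
Context (xs : 'cV[R]_p) (L1 L2 l alpha rho : R) (M : nat).
Hypotheses (Psi_gt : forall y, (-oo < Psi y)%E) (Psi_cvx : convex_efun Psi).
Hypothesis xs_min : is_minimizer (objective g Psi) xs.
Hypotheses (dg : forall y, differentiable g y) (gL : lipschitz_grad L1 g).
Hypotheses (dgg : forall z, differentiable (grad g) z).
Hypotheses (l_gt0 : 0 < l) (gl : strongly_convex l g).
Hypothesis hL : lipschitz_hess L2 g.
Hypotheses (alpha01 : 0 < alpha < 1 / 2) (rho01 : 0 < rho < 1).
Context (T : @sepqn_trace R p) (lH LH : R).
Hypothesis runT : sepqn_run g Psi alpha rho M T.
Hypothesis lH_gt0 : 0 < lH.
Hypothesis HlH : forall k, loewner_le lH%:M (model_hess M T k).
Hypothesis HLH : forall k, loewner_le (model_hess M T k) LH%:M.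
Hypothesis LH_ge0 : 0 <= LH.
Hypothesis DM : dennis_more g xs (model_hess M T) (iterate T).

Let x := iterate T.
Let y := surr_min T.
Let d k := y k - x k.
Let e k := norm2 (x k - xs).
Let n k := norm2 (d k).
Let H := model_hess M T.
Let A := hess g xs.

Lemma iterate_edom k : edom Psi (x k).
Proof.
elim: k => [|k xkD]; first by have /edom_EFinD := run_start runT.
rewrite /x (run_iterate runT).
exact: (next_edom Psi_gt Psi_cvx rho01 xkD (run_surr_min runT k)
  (run_step runT k)).
Qed.

Lemma step_gt0 k : 0 < step T k <= 1.
Proof. exact: (first_backtrack_gt0 rho01 (run_step runT k)). Qed.

Lemma direction_cvg0 (eps : R) : 0 < eps -> \forall k \near \oo, n k <= eps.
Proof.
move=> eps0.
have /andP[al0 _] := alpha01.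
pose c := alpha * step_bound L1 alpha rho lH * lH.
have c0 : 0 < c by rewrite !mulr_gt0// step_bound_gt0.
have : (fun k => c * n k ^+ 2) @ \oo --> 0.
  apply: (@decrease_cvg0 _ (fun k => g (x k) + fine (Psi (x k))) _
    (g xs + fine (Psi xs))).
  - move=> k; have [/edom_EFinD xsD xsmin] := xs_min.
    have /edom_EFinD-/(_ g)/xsmin := iterate_edom k.
    by rewrite /objective (edom_fin Psi_gt xsD)
      (edom_fin Psi_gt (iterate_edom k)).
  - by move=> k; rewrite mulr_ge0 ?sqr_ge0// ltW.
  - move=> k; rewrite /n /d {1 2}/x (run_iterate runT).
    exact: (objective_decrease Psi_gt Psi_cvx dg gL alpha01 rho01 lH_gt0
      (HlH k) (iterate_edom k) (run_surr_min runT k) (run_step runT k)).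
move=> /cvgr_le/(_ (c * eps ^+ 2)); rewrite mulr_gt0 ?exprn_gt0//.
move=> /(_ isT); apply: filterS => k.
by rewrite ler_pM2l// ler_pXn2r// nnegrE ?norm2_ge0// ltW.
Qed.

Lemma error_cvg0 (eps : R) : 0 < eps -> \forall k \near \oo, e k <= eps.
Proof.
(* By the triangle inequality through [y k] and [error_le_direction], [e k <= C * n k]. *)
move=> eps0; pose C := 1 + (`|L1| + LH) / l.
have C0 : 0 < C.
  by rewrite ltr_wpDr// divr_ge0 ?addr_ge0// ltW.
have := direction_cvg0 (divr_gt0 eps0 C0); apply: filterS => k.
rewrite ler_pdivlMr// mulrC => /(le_trans _); apply.
apply: le_trans (norm2_triangle (y k) _ _) _.
rewrite norm2B /C mulrDl mul1r lerD2l mulrAC ler_pdivlMr// mulrC.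
exact: (error_le_direction Psi_gt Psi_cvx xs_min dg gL gl lH_gt0
  (HlH k) (HLH k) (run_surr_min runT k) LH_ge0).
Qed.

(** The actual displacement is [step T k *: d k], and the positive step cancels by homogeneity. The
    criterion thus holds for full directions before the step is known to be [1]. *)
Lemma dennis_more_direction (eps : R) : 0 < eps ->
  \forall k \near \oo, norm2 ((H k - A) *m d k) <= eps * n k.
Proof.
move=> eps0; have /eqoP/(_ eps eps0) := DM; apply: filterS => k.
have /andP[t0 _] := step_gt0 k.
rewrite (run_iterate runT) (addrC (iterate T k)) addrK -scalemxAr !norm2Z.
rewrite (gtr0_norm t0) !ger0_norm ?mulr_ge0 ?norm2_ge0 ?(ltW t0)//.
by rewrite mulrCA ler_pM2l.
Qed.

Lemma step_eq1 : \forall k \near \oo, step T k = 1.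
Proof.
have /andP[al0 al1] := alpha01.
pose c := (1 / 2 - alpha) * lH.
have c0 : 0 < c by rewrite mulr_gt0// subr_gt0.
(* Chosen so that the Taylor error and the Dennis-More error each take at most half of the budget
   [c * n k ^+ 2] in [unit_step]. *)
pose c' := c / (4 * (`|L2| + 1)).
have L0 := normr_ge0 L2.
have c'0 : 0 < c' by rewrite divr_gt0// mulr_gt0//; lra.
have c'E : (`|L2| + 1) * c' = c / 4 by rewrite /c'; field; lra.
near=> k.
have n_le : n k <= c' by near: k; exact: direction_cvg0.
have e_le : e k <= c' by near: k; exact: error_cvg0.
have D_le : norm2 ((H k - A) *m d k) <= c * n k.
  by near: k; exact: dennis_more_direction.
apply: (@unit_step _ _ g Psi xs L2 alpha rho lH Psi_gt Psi_cvx dg alpha01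
  _ _ _ _ (HlH k) (iterate_edom k) (run_surr_min runT k) (run_step runT k)
  dgg hL).
rewrite -/(d k) -/(n k) -/(H k) -/(e k) -/A.
have n0 : 0 <= n k by exact: norm2_ge0.
have e0 : 0 <= e k by exact: norm2_ge0.
have k1 : `|L2| * (e k + n k) * n k ^+ 2 <= c / 2 * n k ^+ 2.
  rewrite ler_wpM2r ?sqr_ge0//.
  apply: (@le_trans _ _ (`|L2| * (c' + c'))); last by lra.
  by rewrite ler_wpM2l// lerD.
have k2 : n k * norm2 ((H k - A) *m d k) <= n k * (c * n k).
  by rewrite ler_wpM2l.
rewrite [leRHS]mulrA -/c; lra.
Unshelve. all: by end_near. Qed.

Lemma error_littleo (eps : R) : 0 < eps ->
  \forall k \near \oo, e k.+1 <= eps * e k.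
Proof.
move=> eps0.
(* From [l * e k.+1 <= eta * (e k.+1 + e k)], the bound [eta <= l / 2] absorbs [e k.+1] on the left,
   and [eta <= l / 2 * eps] gives the required ratio. *)
pose eta := l / 2 * Num.min 1 eps.
have m0 : 0 < Num.min 1 eps by rewrite lt_min ltr01.
have eta0 : 0 < eta by rewrite mulr_gt0// divr_gt0.
have L0 := normr_ge0 L2.
pose eta' := eta / (4 * (`|L2| + 1)).
have eta'0 : 0 < eta' by rewrite divr_gt0// mulr_gt0//; lra.
have eta'E : (`|L2| + 1) * eta' = eta / 4 by rewrite /eta'; field; lra.
near=> k.
have n_le : n k <= eta' by near: k; exact: direction_cvg0.
have e_le : e k <= eta' by near: k; exact: error_cvg0.
have D_le : norm2 ((H k - A) *m d k) <= eta / 2 * n k.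
  by near: k; apply: dennis_more_direction; rewrite divr_gt0.
have t1 : step T k = 1 by near: k; exact: step_eq1.
(* With unit steps, the error bound on the surrogate minimizer becomes one on the next iterate. *)
have xE : x k.+1 = y k by rewrite /x (run_iterate runT) t1 scale1r subrKC.
have n0 : 0 <= n k by exact: norm2_ge0.
have e0 : 0 <= e k by exact: norm2_ge0.
have e0' : 0 <= e k.+1 by exact: norm2_ge0.
have n_le_e : n k <= e k.+1 + e k.
  rewrite /n /d -xE; apply: le_trans (norm2_triangle xs _ _) _.
  by rewrite (norm2B xs).
have k1 : `|L2| * (e k + n k) * n k <= eta / 2 * n k.
  rewrite ler_wpM2r//.
  apply: (@le_trans _ _ (`|L2| * (eta' + eta'))); last by lra.
  by rewrite ler_wpM2l// lerD.
have le1 : l * e k.+1 <= eta * n k.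
  have := error_le_model Psi_gt Psi_cvx xs_min dg gL gl (HlH k)
    (run_surr_min runT k) dgg hL.
  rewrite /e xE -/(d k) -/(n k) -/(H k) -/(e k) -/A; lra.
have le2 : eta * n k <= eta * (e k.+1 + e k) by rewrite ler_wpM2l// ltW.
have le3 : eta * e k.+1 <= l / 2 * e k.+1.
  by rewrite ler_wpM2r// /eta ler_piMr ?ge_min ?lexx// ltW// divr_gt0.
have le4 : eta * e k <= l / 2 * (eps * e k).
  rewrite mulrA ler_wpM2r// /eta ler_wpM2l ?ge_min ?lexx ?orbT//.
  by rewrite ltW// divr_gt0.
rewrite -(ler_pM2l (divr_gt0 l_gt0 (ltr0n R 2))); lra.
Unshelve. all: by end_near. Qed.

Lemma sepqn_superlinear : superlinear_cvg (iterate T) xs.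
Proof.
split.
  apply/cvgrPdist_le => eps eps0; have := error_cvg0 eps0.
  (* Convergence is stated in the max norm, which the Euclidean norm dominates. *)
  apply: filterS => k; rewrite distrC; exact: le_trans (norm_le_norm2 _).
apply/eqoP => eps eps0; have := error_littleo eps0; apply: filterS => k.
by rewrite !ger0_norm ?norm2_ge0.
Qed.

End Run.

Theorem theorem7 (R : realType) (p N : nat) (q : 'I_N -> nat)
    (W : forall i, 'M[R]_(q i, p)) (b : forall i, 'cV[R]_(q i))
    (psi : forall i, 'cV[R]_(q i) -> \bar R)
    (g : 'cV[R]_p -> R) (xstar : 'cV[R]_p)
    (L1 L2 l alpha rho : R) (M : nat) :
  let Psi := nonsmooth_part W b psi in
  let f := objective g Psi in
  (forall i, convex_efun (psi i)) ->
  closed_efun f -> convex_efun f -> is_minimizer f xstar ->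
  closed_efun (EFin \o g) -> proper_efun (EFin \o g) ->
  convex_efun (EFin \o g) ->
  cont_diff g -> lipschitz_grad L1 g ->
  closed_efun Psi -> proper_efun Psi -> convex_efun Psi ->
  0 < alpha < 1 / 2 -> 0 < rho < 1 -> (1 <= M)%N ->
  twice_cont_diff g -> 0 < l -> strongly_convex l g -> lipschitz_hess L2 g ->
  exists2 delta : R, 0 < delta &
    forall T : sepqn_trace,
      sepqn_run g Psi alpha rho M T ->
      norm2 (iterate T 0 - xstar) < delta ->
      dennis_more g xstar (model_hess M T) (iterate T) ->
      (exists lH LH : R, 0 < lH <= LH /\
         forall k, loewner_le lH%:M (model_hess M T k) /\
                   loewner_le (model_hess M T k) LH%:M) ->
      superlinear_cvg (iterate T) xstar.
Proof.
move=> Psi f _ _ _ xs_min _ _ _ _ gL _ [Psi_gt _] Psi_cvx alpha01 rho01 _.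
move=> [dg dgg _] l_gt0 gl hL.
(* Convergence comes from the decrease of the objective rather than from a local argument, so the
   radius can be fixed in advance. *)
exists 1 => // T runT _ DM [lH [LH [/andP[lH_gt0 lHLH] HT]]].
apply: (sepqn_superlinear Psi_gt Psi_cvx xs_min dg gL dgg l_gt0 gl hL
  alpha01 rho01 runT lH_gt0 (fun k => (HT k).1) (fun k => (HT k).2) _ DM).
exact: ltW (lt_le_trans lH_gt0 lHLH).
Qed.
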